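(* Let $\theta\in[0,1]$ and suppose that $\sum_{k=1}^\infty\frac{c_k}{\gamma_k}<a_1^{2(1-\theta)}$. Then the spectrum $\sigma(L)$ of the operator-valued function $$L(\lambda)=\lambda^2I+A^2-\widehat K(\lambda)A^{2\theta}$$ is contained in the left half-plane $\{\lambda\in\mathbb C:\operatorname{Re}\lambda<0\}$.
   Context: $H$ is a separable Hilbert space and $A$ is a self-adjoint positive operator in $H$ with compact inverse. $\{e_n\}_{n\ge1}$ is the orthonormal basis of eigenvectors of $A$, $Ae_n=a_ne_n$, with $1\le a_1\le a_2\le\cdots$ (counted with multiplicity), $a_n\to+\infty$. The numbers $c_k$, $\gamma_k$ satisfy $c_k>0$, $\gamma_{k+1}>\gamma_k>0$ for $k\in\mathbb N$, $\gamma_k\to+\infty$, and $\sup_{k\in\mathbb N}\{\gamma_k(\gamma_{k+1}-\gamma_k)\}=+\infty$. The function $\widehat K(\lambda)=\sum_{k=1}^\infty\frac{c_k}{\lambda+\gamma_k}$ is the Laplace transform of the kernel $K(t)=\sum_{k=1}^\infty c_ke^{-\gamma_kt}$, and $I$ is the identity operator on $H$. $L(\lambda)$ is regarded as an operator in $H$ with domain $\operatorname{dom}(A^2)$. The resolvent set of $L$ is the set of all $\lambda\in\mathbb C$ for which the inverse operator $L^{-1}(\lambda)$ exists and is bounded; the spectrum $\sigma(L)$ is the complement of the resolvent set in $\mathbb C$. *)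

(* Defs.v *)
From HB Require Import structures.
From mathcomp Require Import all_boot all_order all_algebra.
From mathcomp Require Import complex.
From mathcomp Require Import all_classical all_reals all_analysis.

Set Implicit Arguments.
Unset Strict Implicit.
Unset Printing Implicit Defensive.

Import Order.TTheory GRing.Theory Num.Theory.
Import numFieldNormedType.Exports.

Local Open Scope classical_set_scope.
Local Open Scope ring_scope.
Local Open Scope complex_scope.

(* A complex Hilbert space is a complete normed module H over R[i] together   *)
(* with dot : {dot H for Num.conj} (linear in the first variable) inducing    *)
(* the norm. Note that `|x| : R[i], as for any normed module over R[i].       *)
Definition norm_from_dot (R : realType) (H : completeNormedModType R[i])
    (dot : {dot H for Num.conj}) : Prop :=
  forall x : H, dot x x = `|x| ^+ 2.

Definition separable (T : topologicalType) : Prop :=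
  exists2 D : set T, countable D & dense D.

Definition orthonormal_basis (R : realType) (H : completeNormedModType R[i])
    (dot : {dot H for Num.conj}) (e : nat -> H) : Prop :=
  (forall m n, dot (e m) (e n) = (m == n)%:R) /\
  (forall x : H, series (fun n => dot x (e n) *: e n) @ \oo --> x).

(* A possibly unbounded operator; its values outside op_dom are junk. *)
Record partial_op (T : Type) := PartialOp {
  op_dom : set T;
  op_app :> T -> T
}.

Section Operators.
Variables (R : realType) (H : completeNormedModType R[i]).
Variable dot : {dot H for Num.conj}.
Implicit Types T : partial_op H.

Definition linear_op T : Prop :=
  op_dom T 0 /\
  forall (c : R[i]) (x y : H), op_dom T x -> op_dom T y ->
    op_dom T (c *: x + y) /\ T (c *: x + y) = c *: T x + T y.

(* The left-hand side of the equivalence is the graph of the adjoint of T. *)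
Definition self_adjoint T : Prop :=
  [/\ linear_op T, dense (op_dom T)
    & forall y z : H,
        (forall x, op_dom T x -> dot (T x) y = dot x z) <->
        (op_dom T y /\ T y = z)].

Definition positive_op T : Prop :=
  forall x, op_dom T x -> x != 0 -> 0 < dot (T x) x.

Definition is_inverse T (B : {linear H -> H}) : Prop :=
  (forall y, op_dom T (B y) /\ T (B y) = y) /\
  (forall x, op_dom T x -> B (T x) = x).

Definition bounded_op (B : {linear H -> H}) : Prop :=
  exists M : R[i], forall x : H, `|B x| <= M * `|x|.

Definition compact_op (B : {linear H -> H}) : Prop :=
  forall S : set H, bounded_set S -> precompact (B @` S).

Definition sqr_op T : partial_op H :=
  PartialOp [set x | op_dom T x /\ op_dom T (T x)] (fun x => T (T x)).

(* The power A ^ s (s >= 0) of the operator A with A e_n = a_n e_n. *)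
Definition pow_op (a : nat -> R) (e : nat -> H) (s : R) : partial_op H :=
  PartialOp
    [set x | (\sum_(n <oo)
        (a n `^ (2 * s) * complex.Re (`|dot x (e n)| ^+ 2))%:E < +oo)%E]
    (fun x => limn (series (fun n => ((a n `^ s)%:C * dot x (e n)) *: e n))).

(* U is the set on which the operator-valued function F is defined; the       *)
(* points of its complement belong to the spectrum.                           *)
Definition resolvent_set (U : set R[i]) (F : R[i] -> partial_op H) :
    set R[i] :=
  [set l | U l /\ exists2 B : {linear H -> H}, is_inverse (F l) B & bounded_op B].

Definition spectrum (U : set R[i]) (F : R[i] -> partial_op H) : set R[i] :=
  ~` resolvent_set U F.

End Operators.

Section Symbol.
Variables (R : realType) (c g : nat -> R).

Definition Khat_series (l : R[i]) : nat -> R[i]^o :=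
  series (fun k => (c k)%:C / (l + (g k)%:C) : R[i]^o).

(* Division by 0 is total, so the poles have to be excluded explicitly. *)
Definition Khat_dom : set R[i] :=
  [set l | (forall k, l + (g k)%:C != 0) /\ cvgn (Khat_series l)].

Definition Khat (l : R[i]) : R[i] := limn (Khat_series l).

Definition Lop (H : completeNormedModType R[i]) (dot : {dot H for Num.conj})
    (A : partial_op H) (a : nat -> R) (e : nat -> H) (theta : R) (l : R[i]) :
    partial_op H :=
  PartialOp (op_dom (sqr_op A))
    (fun x => l ^+ 2 *: x + sqr_op A x
              - Khat l *: pow_op dot a e (2 * theta) x).

End Symbol.

(* Main.v *)
(** In the eigenbasis the operator L(l) is diagonal, with symbol
    p_n(l) = l^2 + a_n^2 - Khat(l) a_n^(2 theta).  Let Re l >= 0 and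
    S = sum c_k / g_k.  Then |Khat(l)| <= S, and S < a_0^(2(1 - theta)) gives
    |Khat(l)| a_n^(2 theta) <= q a_n^2 with q < 1 independent of n.  Hence
    |p_n(l)| >= (1 - q) a_n^2 - |l|^2, so a_n^2 / p_n(l) is bounded once no
    p_n(l) vanishes.  If Im l <> 0, then Im l * Im Khat(l) < 0, which is
    incompatible with the imaginary part 2 Re l Im l = a_n^(2 theta) Im Khat(l)
    of p_n(l) = 0; if Im l = 0, the bound on Khat(l) excludes it.  The inverse is
    the diagonal operator with coefficients 1 / p_n(l), and it maps into dom(A^2)
    because a vector x belongs to dom(A) as soon as the numbers a_n <x, e_n> are
    the Fourier coefficients of some vector, A being self-adjoint. *)
Require Import Defs.
From HB Require Import structures.
From mathcomp Require Import all_boot all_order all_algebra.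
From mathcomp Require Import complex.
From mathcomp Require Import all_classical all_reals all_analysis.
From mathcomp Require Import lra.
Import Order.TTheory GRing.Theory Num.Theory.
Import numFieldNormedType.Exports.
Local Open Scope classical_set_scope.
Local Open Scope ring_scope.
Local Open Scope complex_scope.

(** * Limits of norm bounds and dominated series of complex numbers *)

Lemma cvg_norm_le {K : numFieldType} (V W : normedModType K) (M : K)
    (u : nat -> V) (v : nat -> W) (l : V) (m : W) :
  0 <= M -> u @ \oo --> l -> v @ \oo --> m ->
  (forall n, `|u n| <= M * `|v n|) -> `|l| <= M * `|m|.
Proof.
move=> M0 /cvgrPdist_lt ul /cvgrPdist_lt vm uv; apply/ler_addgt0Pr => eps eps0.
have M1 : 0 < M + 1 by rewrite ltr_wpDl.
pose d := eps / 2 / (M + 1).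
have d0 : 0 < d by rewrite !divr_gt0.
have e20 : 0 < eps / 2 by rewrite divr_gt0.
near \oo => n.
have lu : `|l - u n| < eps / 2 by near: n; exact: ul.
have mv : `|m - v n| < d by near: n; exact: vm.
have vn : `|v n| <= `|m| + d.
  rewrite -[v n](subKr m) (le_trans (ler_normB _ _))// lerD2l ltW//.
rewrite -[l](subrK (u n)) addrC (le_trans (ler_normD _ _))//.
rewrite [in leRHS](splitr eps) addrA lerD// ?(ltW lu)//.
rewrite (le_trans (uv n))// (le_trans (ler_wpM2l M0 vn))// mulrDr lerD2l.
by rewrite /d mulrA ler_pdivrMr// mulrC ler_pM2l// lerDl.
Unshelve. all: by end_near. Qed.

Section ComplexSeries.
Context {R : realType}.

Lemma cvg_complex (z : nat -> R[i]) (x y : R) :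
  (fun n => complex.Re (z n)) @ \oo --> x ->
  (fun n => complex.Im (z n)) @ \oo --> y ->
  (z : nat -> R[i]^o) @ \oo --> (x +i* y : R[i]^o).
Proof.
move=> /cvgrPdist_lt zx /cvgrPdist_lt zy; apply/cvgrPdist_lt => -[d d'].
(* A positive element of [R[i]] is real, so the radius has imaginary part [0]. *)
rewrite ltcE /= => /andP[/eqP -> d0].
have d2 : 0 < d / 2 by rewrite divr_gt0.
near=> n.
have xn : `|x - complex.Re (z n)| < d / 2 by near: n; exact: zx.
have yn : `|y - complex.Im (z n)| < d / 2 by near: n; exact: zy.
rewrite normc_def ltcR /=.
case: (z n) xn yn => zr zi /= xn yn.
rewrite -(@ltr_pXn2r _ 2)// ?nnegrE ?sqrtr_ge0 ?ltW//.
rewrite sqr_sqrtr ?addr_ge0 ?sqr_ge0// -(real_normK (num_real (x - zr))).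
rewrite -(real_normK (num_real (y - zi))).
have := normr_ge0 (x - zr); have := normr_ge0 (y - zi); nra.
Unshelve. all: by end_near. Qed.

Lemma Re_sum (I : Type) (r : seq I) (F : I -> R[i]) :
  complex.Re (\sum_(i <- r) F i) = \sum_(i <- r) complex.Re (F i).
Proof. by apply: (big_morph (@complex.Re R)) => // -[? ?] [? ?]. Qed.

Lemma Im_sum (I : Type) (r : seq I) (F : I -> R[i]) :
  complex.Im (\sum_(i <- r) F i) = \sum_(i <- r) complex.Im (F i).
Proof. by apply: (big_morph (@complex.Im R)) => // -[? ?] [? ?]. Qed.

Lemma normc_ge_Im (z : R[i]) : `|complex.Im z|%:C <= `|z|.
Proof.
rewrite normc_def lecR -sqrtr_sqr ler_sqrt ?addr_ge0 ?sqr_ge0//.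
by rewrite lerDr sqr_ge0.
Qed.

Lemma cvg_series_dominated (u v : nat -> R) :
  (forall k, `|u k| <= v k) -> cvgn (series v) -> cvgn (series u).
Proof.
move=> uv; move/(series_le_cvg (fun k => normr_ge0 (u k))
  (fun k => le_trans (normr_ge0 _) (uv k)) uv); exact: normed_cvg.
Qed.

(** Domination passes to real and imaginary parts, so real comparison applies to each. The series of
    imaginary parts is kept because the sign of the imaginary part of [Khat] is read off term by
    term. *)
Lemma cvg_complex_series (z : nat -> R[i]) (v : nat -> R) :
    (forall k, `|z k| <= (v k)%:C) -> cvgn (series v) ->
  exists2 w : R[i], (series z : nat -> R[i]^o) @ \oo --> (w : R[i]^o) &
    `|w| <= (limn (series v))%:C /\
    series (fun k => complex.Im (z k)) @ \oo --> complex.Im w.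
Proof.
move=> zv vc.
have zr k : `|complex.Re (z k)| <= v k.
  by rewrite -lecR (le_trans _ (zv k))// normc_ge_Re.
have zi k : `|complex.Im (z k)| <= v k.
  by rewrite -lecR (le_trans _ (zv k))// normc_ge_Im.
have v0 k : 0 <= v k := le_trans (normr_ge0 _) (zr k).
have xc := cvg_series_dominated _ _ zr vc.
have yc := cvg_series_dominated _ _ zi vc.
pose w : R[i] := limn (series (fun k => complex.Re (z k)))
  +i* limn (series (fun k => complex.Im (z k))).
have zw : (series z : nat -> R[i]^o) @ \oo --> (w : R[i]^o).
  apply: cvg_complex.
    by under eq_fun do rewrite Re_sum; exact: xc.
  by under eq_fun do rewrite Im_sum; exact: yc.
exists w => //; split=> //.
have vC : (fun n => (series v n)%:C : R[i]^o) @ \oo -->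
    ((limn (series v))%:C : R[i]^o).
  by apply: cvg_complex => //=; exact: cvg_cst.
have S0 : 0 <= limn (series v).
  by apply: limr_ge => //; apply: nearW => n; exact: sumr_ge0.
have <- : `|(limn (series v))%:C| = (limn (series v))%:C.
  by rewrite ger0_norm ?ler0c.
rewrite -[leRHS]mul1r; apply: (cvg_norm_le _ _ _ _ _ _ _ ler01 zw vC) => n.
rewrite mul1r (le_trans (ler_norm_sum _ _ _))//.
by rewrite ger0_norm ?ler0c ?sumr_ge0// rmorph_sum ler_sum.
Qed.

End ComplexSeries.

(** * The Laplace transform on the closed right half-plane *)

Section Kernel.
Context {R : realType} {c g : nat -> R}.
Hypothesis (c0 : forall k, 0 < c k) (g0 : forall k, 0 < g k).
Hypothesis cg : cvgn (series (fun k => c k / g k)).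

(** For Re l >= 0 each denominator satisfies |l + g_k| >= g_k, so [c k / g k] dominates the series.
    Multiplied by Im l, the imaginary part of the k-th term is -c_k (Im l)^2 / |l + g_k|^2. *)
Lemma Khat_prop (l : R[i]) : 0 <= complex.Re l ->
  [/\ Khat_dom c g l, `|Khat c g l| <= (limn (series (fun k => c k / g k)))%:C &
    complex.Im l != 0 -> complex.Im l * complex.Im (Khat c g l) < 0].
Proof.
case: l => x y /= x0.
have xg k : 0 < x + g k by rewrite ltr_wpDl.
have lg k : (g k)%:C <= `|(x +i* y) + (g k)%:C|.
  rewrite (le_trans _ (normc_ge_Re _))//= lecR ger0_norm ?(ltW (xg k))//.
  by rewrite lerDr.
have gC k : 0 < (g k)%:C :> R[i] by rewrite ltcE /= eqxx g0.
have lg0 k : (x +i* y) + (g k)%:C != 0.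
  by rewrite -normr_gt0; exact: lt_le_trans (gC k) (lg k).
have zv k : `|(c k)%:C / ((x +i* y) + (g k)%:C)| <= (c k / g k)%:C.
  rewrite normrM normfV ger0_norm ?ler0c ?(ltW (c0 k))//.
  rewrite rmorphM fmorphV ler_wpM2l ?ler0c ?(ltW (c0 k))//.
  by rewrite lef_pV2 ?posrE ?normr_gt0 ?gC ?lg0 ?lg.
have [w zw [wv iw]] := cvg_complex_series _ _ zv cg.
have Kw : Khat c g (x +i* y) = w by apply: cvg_lim zw; exact: norm_hausdorff.
rewrite Kw; split=> [||y0]; [split; [exact: lg0|exact: cvgP zw] | exact: wv |].
pose d k := (x + g k) ^+ 2 + y ^+ 2.
have d0 k : 0 < d k by rewrite ltr_wpDr ?sqr_ge0 ?exprn_gt0.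
have neg k : y * complex.Im ((c k)%:C / ((x +i* y) + (g k)%:C)) < 0.
  have -> : y * complex.Im ((c k)%:C / ((x +i* y) + (g k)%:C)) =
      - (c k * y ^+ 2 / d k).
    by rewrite /= mul0r !addr0 !mulrN mulrCA expr2 !mulrA.
  by rewrite oppr_lt0 divr_gt0// mulr_gt0// exprn_even_gt0.
(* Negative partial sums alone only give a limit <= 0; strictness comes from bounding every nonempty
   partial sum by its first term. *)
apply: le_lt_trans (neg 0%N).
pose im k := complex.Im ((c k)%:C / ((x +i* y) + (g k)%:C)).
have yw : (fun n => y * series im n) @ \oo --> y * complex.Im w.
  by apply: cvgM; [exact: cvg_cst | exact: iw].
rewrite -(cvg_lim (@Rhausdorff R) yw); apply: limr_le; first exact: cvgP yw.
exists 1%N => // n /= n1.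
rewrite /series /= big_ltn// mulrDr gerDl mulr_sumr sumr_le0// => k _.
exact: ltW (neg k).
Qed.

End Kernel.

(** * Nonvanishing and growth of the symbol *)

Section Symbol.
Context {R : realType}.

Lemma symbol_neq0 (l k : R[i]) (b r : R) : 0 <= complex.Re l -> 0 < r ->
    `|k| * r%:C < b%:C ->
    (complex.Im l != 0 -> complex.Im l * complex.Im k < 0) ->
  l ^+ 2 + b%:C - k * r%:C != 0.
Proof.
move=> l0 r0 kb yk; have : complex.Re k * r < b.
  rewrite -ltcR (le_lt_trans _ kb)// rmorphM ler_wpM2r ?ler0c ?(ltW r0)//.
  by rewrite (le_trans _ (normc_ge_Re _))// lecR ler_norm.
case: l k l0 yk {kb} => [x y] [u v] /= x0 yk ub.
rewrite eq_complex /= !mulr0 !addr0 subr0 add0r negb_and.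
have [y0|y0] := eqVneq y 0.
  by apply/orP; left; apply/eqP; rewrite y0; nra.
apply/orP; right; apply/eqP => h; have := yk y0.
(* The vanishing imaginary part is multiplied by [y]: the right side is nonnegative since [x >= 0],
   while [y * v < 0] and [r > 0] make the left side negative. *)
have : y * (v * r) = 2 * x * y ^+ 2 by nra.
nra.
Qed.

(** Serves for A n = a_n^2 and P n = |p_n(l)|. Once A n >= 2L / (1 - q), the constant L is at most
    half of (1 - q) A n, which leaves A n <= 2 / (1 - q) * P n. *)
Lemma dominated_of_affine (A P : nat -> R) (q L : R) : q < 1 ->
    A @ \oo --> +oo -> (forall n, 0 < P n) ->
    (forall n, A n <= P n + L + q * A n) ->
  exists M, forall n, A n <= M * P n.
Proof.
move=> q1 /cvgryPge Ay P0 AP; have q0 : 0 < 1 - q by rewrite subr_gt0.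
have [N _ AN] := Ay (2 * L / (1 - q)).
(* The sum takes care of the finitely many [n < N], each through its own ratio. *)
exists (2 / (1 - q) + \sum_(k < N) `|A k / P k|) => n.
rewrite mulrDl; have [nN|Nn] := ltnP n N.
  apply: ler_wpDl; first by rewrite mulr_ge0 ?ltW// divr_gt0.
  rewrite -ler_pdivrMr// (bigD1 (Ordinal nN))//= ler_wpDr ?ler_norm//.
  exact: sumr_ge0.
apply: ler_wpDr; first by rewrite mulr_ge0 ?(ltW (P0 n))// sumr_ge0.
rewrite mulrAC ler_pdivlMr//.
by have := AN _ Nn; rewrite /= ler_pdivrMr//; have := AP n; nra.
Qed.

End Symbol.

Lemma cvg_series_lt {R : realType} (v : nat -> R) (b : R) :
    (forall k, 0 <= v k) -> (\sum_(k <oo) (v k)%:E < b%:E)%E ->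
  cvgn (series v) /\ limn (series v) < b.
Proof.
move=> v0 vb.
have v0E k : (0 <= (v k)%:E)%E by rewrite lee_fin.
have vfin : (\sum_(k <oo) (v k)%:E)%E \is a fin_num.
  by rewrite ge0_fin_numE ?(lt_trans vb) ?ltry// nneseries_ge0.
have sv n : series v n <= fine (\sum_(k <oo) (v k)%:E)%E.
  by rewrite -lee_fin fineK// -sumEFin; apply: nneseries_lim_ge.
have vc : cvgn (series v).
  apply: nondecreasing_is_cvgn; first exact: nondecreasing_series.
  by exists (fine (\sum_(k <oo) (v k)%:E)%E) => _ [n _ <-].
split=> //; apply: le_lt_trans (limr_le vc (nearW _ sv)) _.
by rewrite -lte_fin fineK.
Qed.

(** * Inner product, orthonormal expansions and bounded diagonal operators *)

Section Hilbert.
Context {R : realType} {H : completeNormedModType R[i]}.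
Context {dot : {dot H for Num.conj}}.
Hypothesis hdot : norm_from_dot dot.

Lemma dotC (x y : H) : dot x y = Num.conj (dot y x).
Proof. by rewrite hermC expr0 mul1r. Qed.

(** Cauchy-Schwarz: [a *: y] is the projection of [x] on [y], and the squared norm of [x - a *: y]
    is nonnegative. *)
Lemma norm_dot_le (x y : H) : `|dot x y| <= `|x| * `|y|.
Proof.
have [->|y0] := eqVneq y 0; first by rewrite linear0r !normr0 mulr0.
have ny : 0 < `|y| by rewrite normr_gt0.
have yJ : Num.conj `|y| = `|y| by apply: conj_Creal; exact: normr_real.
pose d := dot x y; pose a := d / `|y| ^+ 2.
have := dnorm_ge0 dot (x - a *: y).
rewrite dnormB dnormZ linearZr_LR /= !hdot -/d.
have -> : Num.conj a * d = `|d| ^+ 2 / `|y| ^+ 2.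
  by rewrite /a rmorphM fmorphV rmorphXn /= yJ mulrAC [Num.conj d * d]mulrC -normCK.
rewrite rmorphM fmorphV !rmorphXn /= yJ conj_normC.
rewrite /a normrM exprMn normfV normrX normr_id.
have -> : `|d| ^+ 2 * (`|y| ^+ 2)^-1 ^+ 2 * `|y| ^+ 2 = `|d| ^+ 2 / `|y| ^+ 2.
  by rewrite -mulrA [_^-1 ^+ 2]expr2 divfK// expf_neq0// gt_eqF.
rewrite opprD addrA addrK subr_ge0 ler_pdivrMr ?exprn_gt0// -exprMn.
by rewrite ler_pXn2r ?nnegrE ?mulr_ge0.
Qed.

Lemma cvg_dotl (u : nat -> H) (x y : H) :
  u @ \oo --> x -> (fun n => (dot (u n) y : R[i]^o)) @ \oo --> (dot x y : R[i]^o).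
Proof.
move=> /cvgrPdist_lt ux; apply/cvgrPdist_lt => d d0.
have y1 : 0 < `|y| + 1 by rewrite ltr_wpDl.
have := ux _ (divr_gt0 d0 y1); apply: filterS => n xu.
rewrite -linearBl (le_lt_trans (norm_dot_le _ _))//.
rewrite (@le_lt_trans _ _ (`|x - u n| * (`|y| + 1)))//.
  by rewrite ler_wpM2l// lerDl.
by rewrite -ltr_pdivlMr.
Qed.

Context {e : nat -> H}.
Hypothesis he : orthonormal_basis dot e.

Lemma dot_basis m n : dot (e m) (e n) = (m == n)%:R.
Proof. by case: he. Qed.

Lemma fourier_cvg (x : H) : series (fun n => dot x (e n) *: e n) @ \oo --> x.
Proof. by case: he. Qed.

Lemma fourier_inj (x y : H) : (forall n, dot x (e n) = dot y (e n)) -> x = y.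
Proof.
move=> xy; have := fourier_cvg x.
rewrite (_ : (fun n => _) = (fun n => dot y (e n) *: e n)); last first.
  by apply/funext => n; rewrite xy.
by move=> /cvg_unique => /(_ (@norm_hausdorff _ _)); apply; exact: fourier_cvg.
Qed.

(** Pythagoras, over any duplicate-free list so as to cover both partial sums and Cauchy blocks. *)
Lemma norm_sum_basis (w : nat -> R[i]) (r : seq nat) : uniq r ->
  `|\sum_(k <- r) w k *: e k| ^+ 2 = \sum_(k <- r) `|w k| ^+ 2.
Proof.
elim: r => [|k r IH] /=; first by rewrite !big_nil normr0 expr0n.
move=> /andP[kr ur]; rewrite !big_cons -hdot dnormD dnormZ dot_basis eqxx mulr1.
have -> : dot (w k *: e k) (\sum_(j <- r) w j *: e j) = 0.
  rewrite linear_sumr big_seq big1 // => j jr.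
  rewrite linearZr_LR linearZl_LR /= dot_basis.
  by case: eqP jr kr => [->->//|_ _ _]; rewrite !mulr0.
by rewrite rmorph0 !addr0 hdot IH.
Qed.

Lemma norm_sum_basis_le (m w : nat -> R[i]) (M : R[i]) (r : seq nat) : uniq r ->
    (forall n, `|m n| <= M) ->
  `|\sum_(k <- r) (m k * w k) *: e k| <= M * `|\sum_(k <- r) w k *: e k|.
Proof.
move=> ur mM; have M0 : 0 <= M := le_trans (normr_ge0 _) (mM 0%N).
rewrite -(@ler_pXn2r _ 2)// ?nnegrE ?mulr_ge0// exprMn.
rewrite !norm_sum_basis// mulr_sumr ler_sum// => k _.
by rewrite normrM exprMn ler_wpM2r ?exprn_ge0// ler_pXn2r ?nnegrE.
Qed.

(** Cauchy criterion: each block is at most [M] times the same block of the Fourier series of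
    [x]. *)
Lemma diag_series_cvg (m : nat -> R[i]) (M : R[i]) (x : H) :
    (forall n, `|m n| <= M) ->
  cvgn (series (fun n => (m n * dot x (e n)) *: e n)).
Proof.
move=> mM; have M0 : 0 <= M := le_trans (normr_ge0 _) (mM 0%N).
have M1 : 0 < M + 1 by rewrite ltr_wpDl.
apply/cauchy_cvgP/cauchy_seriesP => d d0.
have /cvgP/cauchy_cvgP/cauchy_seriesP := fourier_cvg x.
move=> /(_ _ (divr_gt0 d0 M1)); apply: filterS => n xn.
rewrite (le_lt_trans (norm_sum_basis_le _ _ _ _ _ mM)) ?iota_uniq//.
rewrite (@le_lt_trans _ _ ((M + 1) * `|\sum_(n.1 <= k < n.2) dot x (e k) *: e k|))//.
  by rewrite ler_wpM2r// lerDl.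
by rewrite mulrC -ltr_pdivlMr.
Qed.

Definition diag_op (m : nat -> R[i]) (x : H) : H :=
  limn (series (fun n => (m n * dot x (e n)) *: e n)).

Section Diag.
Context {m : nat -> R[i]} {M : R[i]}.
Hypothesis mM : forall n, `|m n| <= M.

Lemma dot_diag_op x k : dot (diag_op m x) (e k) = m k * dot x (e k).
Proof.
have /(cvg_dotl _ _ (e k)) := diag_series_cvg _ _ x mM.
move=> /cvg_unique => /(_ (@norm_hausdorff _ _)); apply.
apply: cvg_near_cst; exists k.+1 => // n /= kn.
rewrite linear_sumlz big_mkord (bigD1 (Ordinal kn))//= big1 => [|j jk].
  by rewrite addr0 linearZl_LR /= dot_basis eqxx mulr1.
by rewrite linearZl_LR /= dot_basis (negbTE (jk : (j : nat) != k)) mulr0.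
Qed.

Lemma diag_op_linear : linear (diag_op m).
Proof.
move=> b x y; apply: fourier_inj => n.
by rewrite dot_diag_op !linearPl /= !dot_diag_op mulrDr mulrCA.
Qed.

Lemma diag_op_bounded x : `|diag_op m x| <= M * `|x|.
Proof.
have M0 : 0 <= M := le_trans (normr_ge0 _) (mM 0%N).
apply: (cvg_norm_le _ _ _ _ _ _ _ M0 (diag_series_cvg _ _ x mM) (fourier_cvg x)) => n.
by apply: norm_sum_basis_le => //; exact: iota_uniq.
Qed.

End Diag.

(** * The self-adjoint operator, its powers and the inverse in the eigenbasis *)

Context {A : partial_op H} {a : nat -> R}.
Hypothesis hA : self_adjoint dot A.
Hypothesis hAe : forall n, op_dom A (e n) /\ A (e n) = (a n)%:C *: e n.

Lemma dot_eigen x n : op_dom A x -> dot (A x) (e n) = (a n)%:C * dot x (e n).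
Proof.
move=> Ax; case: hA => _ _ /(_ (e n) ((a n)%:C *: e n)) [_ /(_ (hAe n)) ->//].
by rewrite linearZr_LR /= conj_Creal// complex_real.
Qed.

(** The domain of a self-adjoint operator is that of its adjoint, so it suffices that <Au, x> = <u,
    z> for all u in dom(A). Expanding x and z in the basis, the two sides agree term by term by
    [dot_eigen] for u. *)
Lemma dot_eigenP x z : (forall n, dot z (e n) = (a n)%:C * dot x (e n)) ->
  op_dom A x /\ A x = z.
Proof.
move=> zx; case: hA => _ _ /(_ x z) [adj _]; apply: adj => u Au.
rewrite dotC [RHS]dotC; congr (Num.conj _).
have xAu := cvg_dotl _ _ (A u) (fourier_cvg x).
have zu := cvg_dotl _ _ u (fourier_cvg z).
apply: (cvg_unique (@norm_hausdorff _ _) xAu).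
apply: cvg_trans zu; apply: near_eq_cvg; apply: nearW => n /=.
rewrite !linear_sumlz; apply: eq_bigr => k _.
rewrite !linearZl_LR /= zx [dot (e k) (A u)]dotC dot_eigen// rmorphM /= -dotC.
by rewrite conj_Creal ?complex_real// mulrCA mulrA.
Qed.

(** The limit defining [pow_op] is meaningful only if its series converges. On dom(A^2) it is the
    series of a diagonal operator applied to A^2 x, with coefficients a_n^s / a_n^2 <= 1. *)
Lemma pow_opE s x : 1 <= a 0%N -> (forall n, a n <= a n.+1) -> s <= 2 ->
  op_dom (sqr_op A) x ->
  forall n, dot (pow_op dot a e s x) (e n) = (a n `^ s)%:C * dot x (e n).
Proof.
move=> a0 a_nd s2 [Ax AAx] n.
have a1 k : 1 <= a k by elim: k => // k /le_trans; apply.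
have a_gt0 k : 0 < a k := lt_le_trans ltr01 (a1 k).
pose m k : R[i] := (a k `^ s / a k ^+ 2)%:C.
have mM k : `|m k| <= 1.
  rewrite ger0_norm ?ler0c ?divr_ge0 ?powR_ge0 ?exprn_ge0 ?(ltW (a_gt0 k))//.
  rewrite lecR ler_pdivrMr ?exprn_gt0// mul1r -powR_mulrn ?(ltW (a_gt0 k))//.
  exact: (ler_powR (a1 k)).
have coefE k : m k * dot (A (A x)) (e k) = (a k `^ s)%:C * dot x (e k).
  rewrite !dot_eigen// !mulrA; congr (_ * _).
  rewrite /m -!rmorphM; congr (_%:C).
  by rewrite -mulrA -expr2 divfK// expf_neq0// gt_eqF.
rewrite -coefE -(dot_diag_op mM); congr (dot _ _).
by rewrite /diag_op /=; under [in RHS]eq_fun do rewrite coefE.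
Qed.

Lemma diag_inverse (s M : R) (l k : R[i]) : 1 <= a 0%N ->
    (forall n, a n <= a n.+1) -> s <= 2 ->
    (forall n, (a n ^+ 2)%:C <=
      M%:C * `|l ^+ 2 + (a n ^+ 2)%:C - k * (a n `^ s)%:C|) ->
  exists2 B : {linear H -> H},
    is_inverse (PartialOp (op_dom (sqr_op A))
      (fun x => l ^+ 2 *: x + sqr_op A x - k *: pow_op dot a e s x)) B
    & bounded_op B.
Proof.
move=> a0 a_nd s2 hp.
pose p n := l ^+ 2 + (a n ^+ 2)%:C - k * (a n `^ s)%:C.
have a1 n : 1 <= a n by elim: n => // n /le_trans; apply.
have a_gt0 n : 0 < a n := lt_le_trans ltr01 (a1 n).
have p0 n : p n != 0.
  apply/eqP => pn; have := hp n; rewrite -/(p n) pn normr0 mulr0.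
  by apply/negP; rewrite -real_ltNge ?complex_real// ltcR exprn_gt0.
(* One bound for three multipliers: [b n] equal to [1], [a n] and [a n ^+ 2] yields the coefficients
   of [B y], [A (B y)] and [A (A (B y))]. *)
have pM (b : nat -> R) (b0 : forall n, 0 <= b n <= a n ^+ 2) n :
    `|(b n)%:C / p n| <= M%:C.
  have /andP[bn ba] := b0 n.
  rewrite normrM normfV ler_pdivrMr ?normr_gt0// (le_trans _ (hp n))//.
  by rewrite ger0_norm ?ler0c// lecR.
have a2 n : 1 <= a n ^+ 2 by rewrite exprn_ege1.
have a_le n : a n <= a n ^+ 2 by rewrite ler_eXnr.
have /pM m0 n : 0 <= (1 : R) <= a n ^+ 2 by rewrite ler01 a2.
have /pM m1 n : 0 <= a n <= a n ^+ 2 by rewrite (ltW (a_gt0 n)) a_le.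
have /pM m2 n : 0 <= a n ^+ 2 <= a n ^+ 2 by rewrite sqr_ge0 lexx.
have lin := diag_op_linear m0.
pose m n : R[i] := 1%:C / p n.
pose B : {linear H -> H} :=
  HB.pack (diag_op m) (GRing.isLinear.Build _ _ _ _ (diag_op m) lin).
have dotB y n : dot (B y) (e n) = m n * dot y (e n) := dot_diag_op m0 y n.
(* [dot_eigenP] asks for a vector with the coefficients of [A (B y)]; the diagonal operator a_n /
   p_n supplies it, and a_n^2 / p_n does so for the second application of [A]. *)
have domB y : op_dom (sqr_op A) (B y).
  have [|AB ABE] := @dot_eigenP (B y) (diag_op (fun n => (a n)%:C / p n) y).
    by move=> n; rewrite (dot_diag_op m1) dotB mulrA /m mul1r.
  have [|AAB _] := @dot_eigenP (A (B y)) (diag_op (fun n => (a n ^+ 2)%:C / p n) y).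
    by move=> n; rewrite ABE (dot_diag_op m1) (dot_diag_op m2) !mulrA -rmorphM.
  by split.
set T := PartialOp _ _.
have dotT x n : op_dom T x -> dot (T x) (e n) = p n * dot x (e n).
  move=> Tx; have [Ax AAx] := Tx.
  rewrite /= linearBl linearDl (linearZl_LR dot _ (l ^+ 2)) (linearZl_LR dot _ k).
  rewrite /= pow_opE// !dot_eigen//.
  by rewrite /p mulrBl mulrDl expr2 rmorphM -!mulrA.
exists B; last by exists M%:C => x; exact: (diag_op_bounded m0).
split=> [y|x Tx].
  split; first exact: domB.
  apply: fourier_inj => n; have := dotT (B y) n (domB y).
  by rewrite dotB /m mul1r mulVKf.
by apply: fourier_inj => n; rewrite dotB dotT// /m mul1r mulKf.
Qed.

End Hilbert.

(** * Symbol bounds uniform in [n], and the location of the spectrum *)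

Theorem theorem3p1 (R : realType) (H : completeNormedModType R[i])
  (dot : {dot H for Num.conj}) (hdot : norm_from_dot dot)
  (hsep : separable H)
  (A : partial_op H)
  (hAsa : self_adjoint dot A) (hApos : positive_op dot A)
  (hAinv : exists2 B : {linear H -> H}, is_inverse A B & compact_op B)
  (e : nat -> H) (a : nat -> R)
  (he : orthonormal_basis dot e)
  (hAe : forall n, op_dom A (e n) /\ A (e n) = (a n)%:C *: e n)
  (ha1 : 1 <= a 0%N) (ha : forall n, a n <= a n.+1)
  (hainf : a n @[n --> \oo] --> +oo)
  (c g : nat -> R)
  (hc : forall k, 0 < c k) (hg : forall k, 0 < g k < g k.+1)
  (hginf : g k @[k --> \oo] --> +oo)
  (hgsup : ereal_sup (range (fun k => (g k * (g k.+1 - g k))%:E)) = +oo%E)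
  (theta : R) (htheta : 0 <= theta <= 1)
  (hsum : (\sum_(k <oo) (c k / g k)%:E < (a 0%N `^ (2 * (1 - theta)))%:E)%E) :
  spectrum (Khat_dom c g) (Lop c g dot A a e theta)
    `<=` [set l : R[i] | complex.Re l < 0].
Proof.
move=> l /= l_spec; rewrite ltNge; apply/negP => l0; apply: l_spec.
have g0 k : 0 < g k by have /andP[] := hg k.
have a1 n : 1 <= a n by elim: n => // n /le_trans; apply.
have a_gt0 n : 0 < a n := lt_le_trans ltr01 (a1 n).
have [t0 t1] := andP htheta.
have [cg Sq] := cvg_series_lt _ _ (fun k => ltW (divr_gt0 (hc k) (g0 k))) hsum.
have [lK KS imK] := Khat_prop hc g0 cg l l0.
set S := limn _ in Sq KS.
have S0 : 0 <= S by rewrite -ler0c (le_trans _ KS).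
pose b := a 0%N `^ (2 * (1 - theta)).
have b0 : 0 < b by exact: powR_gt0.
(* [S / b] is the constant q: a_n >= a_0 and 2(1 - theta) >= 0 give a_n^(2(1 - theta)) >= b, and q <
   1 is the summability hypothesis. *)
have Sa n : S * a n `^ (2 * theta) <= S / b * a n ^+ 2.
  have -> : a n ^+ 2 = a n `^ (2 * (1 - theta)) * a n `^ (2 * theta).
    rewrite -powRD ?(gt_eqF (a_gt0 n)) ?implybT// -powR_mulrn ?(ltW (a_gt0 n))//.
    by congr (_ `^ _); lra.
  rewrite mulrA ler_wpM2r ?powR_ge0// mulrAC ler_pdivlMr// ler_wpM2l//.
  rewrite ge0_ler_powR ?nnegrE ?(ltW (a_gt0 _))//; first by lra.
  by elim: n => // n /le_trans; apply.
have q1 : S / b < 1 by rewrite ltr_pdivrMr// mul1r.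
pose p n := l ^+ 2 + (a n ^+ 2)%:C - Khat c g l * (a n `^ (2 * theta))%:C.
have Ka n : `|Khat c g l| * (a n `^ (2 * theta))%:C <= (S / b * a n ^+ 2)%:C.
  rewrite (le_trans (ler_wpM2r _ KS)) ?ler0c ?powR_ge0//.
  by rewrite -rmorphM lecR.
have p0 n : p n != 0.
  apply: symbol_neq0 => //; first exact: powR_gt0.
  by rewrite (le_lt_trans (Ka n))// ltcR gtr_pMl ?exprn_gt0.
(* Norms take values in [R[i]]; [N] is the norm as a real number, as [dominated_of_affine]
   requires. *)
pose N (z : R[i]) := complex.Re `|z|.
have NE z : (N z)%:C = `|z| by rewrite RRe_real// normr_real.
have [M pM] : exists M, forall n, a n ^+ 2 <= M * N (p n).
  apply: (dominated_of_affine _ _ (S / b) (N (l ^+ 2)) q1) => [|n|n].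
  - apply/cvgryPge => B; near=> n; rewrite (@le_trans _ _ (a n)) ?ler_eXnr//.
    by near: n; move/cvgryPge: hainf; apply.
  - by rewrite -ltcR NE normr_gt0.
  - rewrite -lecR !rmorphD /= !NE -[leLHS]ger0_norm ?ler0c ?sqr_ge0//.
    have -> : (a n ^+ 2)%:C = p n - l ^+ 2 + Khat c g l * (a n `^ (2 * theta))%:C.
      by rewrite /p addrAC subrK addrAC subrr add0r.
    rewrite (le_trans (ler_normD _ _))// lerD ?ler_normB// normrM.
    by rewrite [X in _ * X]ger0_norm ?ler0c ?powR_ge0// Ka.
split=> //=.
apply: (diag_inverse hdot he hAsa hAe (2 * theta) M) => //; first lra.
by move=> n; rewrite -NE -rmorphM lecR; exact: pM.
Unshelve. all: by end_near. Qed.
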